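(* Let $G$ be a group, $R$ a commutative $G$-graded ring with nonzero unity, and $M$ a nonzero $G$-graded $R$-module. Then every proper graded $R$-submodule of $M$ is a graded $r$-submodule of $M$ if and only if $aK=K$ for every graded $R$-submodule $K$ of $M$ and for all $a\in h(R)-Z(M)$.
   Context: A commutative ring $R$ is $G$-graded if $R=\bigoplus_{g\in G}R_g$ with additive subgroups $R_g$ satisfying $R_gR_h\subseteq R_{gh}$; an $R$-module $M$ is $G$-graded if $M=\bigoplus_{g\in G}M_g$ with additive subgroups $M_g$ satisfying $R_gM_h\subseteq M_{gh}$. Put $h(R)=\bigcup_{g\in G}R_g$ and $h(M)=\bigcup_{g\in G}M_g$. An $R$-submodule $K$ of $M$ is graded if $K=\bigoplus_{g\in G}(K\cap M_g)$. Notation: $Ann_M(a)=\{m\in M: am=0\}$ for $a\in R$; $Z(M)=\{a\in h(R): Ann_M(a)\neq\{0\}\}$; $h(R)-Z(M)$ is the set difference. A proper graded $R$-submodule $K$ of $M$ is a graded $r$-submodule if whenever $a\in h(R)$ and $x\in h(M)$ satisfy $ax\in K$ and $Ann_M(a)=\{0\}$, then $x\in K$. *)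

(* Defs.v *)
From HB Require Import structures.
From mathcomp Require Import all_boot all_order all_algebra.
From mathcomp Require Import boolp classical_sets functions cardinality fsbigop.

Set Implicit Arguments.
Unset Strict Implicit.
Unset Printing Implicit Defensive.

Import GRing.Theory.

Local Open Scope classical_set_scope.
Local Open Scope ring_scope.

(* [\sum_(i \in _)] is 0 when the support of the summand is infinite, hence    *)
(* the explicit finiteness condition.                                         *)
Definition decomposes (I : choiceType) (V : zmodType) (A : I -> set V)
    (f : I -> V) (x : V) : Prop :=
  [/\ forall i, A i (f i),
      finite_set (f @^-1` [set~ 0])
    & x = \sum_(i \in [set: I]) f i].

(* Internal direct sum of additive subgroups: W = \bigoplus_i A i.            *)
Definition is_direct_sum (I : choiceType) (V : zmodType) (A : I -> set V)
    (W : set V) : Prop :=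
  [/\ forall i, GRing.zmod_closed [in A i],
      forall x, W x <-> exists f, decomposes A f x
    & forall f g x, decomposes A f x -> decomposes A g x -> f =1 g].

Definition graded_ring (G : groupType) (R : comNzRingType)
    (Rg : G -> set R) : Prop :=
  is_direct_sum Rg [set: R] /\
  forall g h a b, Rg g a -> Rg h b -> Rg (g * h)%g (a * b).

Definition graded_module (G : groupType) (R : comNzRingType)
    (M : lmodType R) (Rg : G -> set R) (Mg : G -> set M) : Prop :=
  is_direct_sum Mg [set: M] /\
  forall g h a m, Rg g a -> Mg h m -> Mg (g * h)%g (a *: m).

Definition homogeneous (G : groupType) (V : zmodType) (A : G -> set V) : set V :=
  \bigcup_(g in [set: G]) A g.

Definition graded_submodule (G : groupType) (R : comNzRingType)
    (M : lmodType R) (Mg : G -> set M) (K : set M) : Prop :=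
  GRing.submod_closed [in K] /\ is_direct_sum (fun g => K `&` Mg g) K.

Definition Ann (R : comNzRingType) (M : lmodType R) (a : R) : set M :=
  [set m | a *: m = 0].
Arguments Ann {R} M a.

Definition zero_divisors (G : groupType) (R : comNzRingType) (M : lmodType R)
    (Rg : G -> set R) : set R :=
  [set a | homogeneous Rg a /\ Ann M a <> [set 0]].

Definition graded_r_submodule (G : groupType) (R : comNzRingType)
    (M : lmodType R) (Rg : G -> set R) (Mg : G -> set M) (K : set M) : Prop :=
  [/\ graded_submodule Mg K,
      K <> [set: M]
    & forall a x, homogeneous Rg a -> homogeneous Mg x ->
        K (a *: x) -> Ann M a = [set 0] -> K x].

(* Main.v *)
Require Import Defs.
From mathcomp Require Import all_boot all_order all_algebra finmap.
From mathcomp Require Import boolp classical_sets functions cardinality fsbigop.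

(** The bridge between the two conditions is the submodule aK, for a
homogeneous of degree g with zero annihilator. Multiplication by a shifts
degrees, sending the component of degree h of an element to a component of
degree gh, so aK is again a graded submodule whenever K is
([graded_submodule_scale]).

Suppose every proper graded submodule is a graded r-submodule. If aK is the
whole module, then K, which contains aK, equals it. Otherwise aK is a graded
r-submodule, and every homogeneous x in K satisfies ax in aK, whence x lies in
aK; since K is generated additively by its homogeneous elements, K is contained
in aK.

Conversely suppose aK = K. If ax lies in K then ax = ak for some k in K, and
x = k because a annihilates only 0. *)

Set Implicit Arguments.
Unset Strict Implicit.

Import GRing.Theory.

Local Open Scope classical_set_scope.
Local Open Scope ring_scope.

Lemma fsum_closed (I : choiceType) (V : zmodType) (A : set V) (f : I -> V) :
  GRing.zmod_closed [in A] -> (forall i, A (f i)) -> A (\sum_(i \in [set: I]) f i).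
Proof.
move=> [A0 AB] Af; apply: big_ind => //; first exact: set_mem.
have AN x : x \in A -> - x \in A by move=> Ax; rewrite -sub0r; apply: AB.
move=> x y /mem_set Ax /mem_set Ay; apply: set_mem.
by rewrite -[y]opprK; apply: AB => //; exact: AN.
Qed.

(** Scaling distributes only over sums with finite support: with infinite
support the sum on the left is 0 by convention, while a may kill all but
finitely many terms of the sum on the right. *)
Lemma scaler_fsumr (R : pzRingType) (V : lmodType R) (I : choiceType) (a : R)
    (f : I -> V) : finite_set (f @^-1` [set~ 0]) ->
  a *: (\sum_(i \in [set: I]) f i) = \sum_(i \in [set: I]) a *: f i.
Proof.
move=> finf; pose S := fset_set (f @^-1` [set~ 0]).
have fS i : i \notin S -> f i = 0.
  rewrite in_fset_set //; apply: contraNeq => /eqP fi0; exact: mem_set.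
rewrite (fsbigTE S f fS) (fsbigTE S) ?scaler_sumr // => i /fS ->.
by rewrite scaler0.
Qed.

Section Scaling.
Variables (G : groupType) (R : comNzRingType) (M : lmodType R).

(** The component of degree h of ax comes from the component of degree g^-1 h
of x. *)
Lemma decomposes_scale (A B : G -> set M) (g : G) (a : R) (f : G -> M) (x : M) :
  (forall h m, A h m -> B (g * h)%g (a *: m)) -> decomposes A f x ->
  decomposes B (fun h => a *: f (g^-1 * h)%g) (a *: x).
Proof.
move=> AB [Af finf ->]; split.
- by move=> h; rewrite -{1}[h](mulVKg g); exact: AB.
- apply: (sub_finite_set _ (finite_image (fun h => (g * h)%g) finf)) => h /= afh.
  exists (g^-1 * h)%g; last exact: mulVKg.
  by move=> fh0; apply: afh; rewrite fh0 scaler0.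
- rewrite scaler_fsumr // (reindex_fsbigT (fun h => (g^-1 * h)%g)) //.
  exists (fun h => (g * h)%g) => h; [exact: mulVKg | exact: mulKg].
Qed.

Lemma submod_closed_scale (K : set M) (a : R) :
  GRing.submod_closed [in K] ->
  GRing.submod_closed [in [set a *: x | x in K]].
Proof.
move=> [K0 KL]; split.
  by apply: mem_set; exists 0; [exact: set_mem | rewrite scaler0].
move=> b _ _ /set_mem[u Ku <-] /set_mem[v Kv <-]; apply: mem_set.
exists (b *: u + v); first by apply: set_mem; apply: KL; exact: mem_set.
by rewrite scalerDr !scalerA mulrC.
Qed.

Lemma zmod_closedI (V : zmodType) (A B : set V) :
  GRing.zmod_closed [in A] -> GRing.zmod_closed [in B] ->
  GRing.zmod_closed [in A `&` B].
Proof.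
move=> [A0 AB] [B0 BB]; split=> [|x y].
  by rewrite in_setI; apply/andP; split.
rewrite !in_setI => /andP[Ax Bx] /andP[Ay By].
by apply/andP; split; [exact: AB | exact: BB].
Qed.

Lemma submod_closed_scale_sub (K : set M) (a : R) :
  GRing.submod_closed [in K] -> [set a *: x | x in K] `<=` K.
Proof.
move=> [K0 KL] _ [x Kx <-]; apply: set_mem; rewrite -[a *: x]addr0.
by apply: KL => //; exact: mem_set.
Qed.

Variables (Rg : G -> set R) (Mg : G -> set M).
Hypothesis gradM : graded_module Rg Mg.

Lemma graded_submodule_scale (K : set M) (a : R) :
  homogeneous Rg a -> graded_submodule Mg K ->
  graded_submodule Mg [set a *: x | x in K].
Proof.
move=> [g _ Rga] [Ksub [_ Kdec _]].
have aKsub := submod_closed_scale a Ksub.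
have aKz := GRing.submod_closedB aKsub.
have [[Mz _ Muniq] RM] := gradM.
split=> //; split.
- by move=> h; apply: zmod_closedI.
- move=> x; split; last first.
    by move=> [f [faK _ ->]]; apply: fsum_closed => // h; case: (faK h).
  move=> [k Kk <-]; have [f fk] := (Kdec k).1 Kk.
  exists (fun h => a *: f (g^-1 * h)%g); apply: decomposes_scale fk => h m [Km Mm].
  by split; [exists m | exact: RM].
- move=> f1 f2 x [f1aK fin1 x1] [f2aK fin2 x2].
  by apply: (Muniq _ _ x); split=> // h; [case: (f1aK h) | case: (f2aK h)].
Qed.

Lemma graded_submodule_sub (K L : set M) :
  graded_submodule Mg K -> graded_submodule Mg L ->
  K `&` homogeneous Mg `<=` L -> K `<=` L.
Proof.
move=> [_ [_ Kdec _]] [Lsub _] KL x /Kdec[f [Kf _ ->]].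
apply: fsum_closed; first exact: GRing.submod_closedB Lsub.
by move=> h; apply: KL; have [Kfh Mfh] := Kf h; split=> //; exists h.
Qed.

End Scaling.

Lemma Ann0_inj (R : comNzRingType) (M : lmodType R) (a : R) :
  Ann M a = [set 0] -> injective (fun m : M => a *: m).
Proof.
move=> Ann0 x y /= axy; apply: subr0_eq.
by rewrite -[_ = 0]/([set 0] (x - y)) -Ann0 /Ann /= scalerBr axy subrr.
Qed.

Unset Implicit Arguments.
Set Strict Implicit.

Theorem theorem3p15 (G : groupType) (R : comNzRingType) (M : lmodType R)
    (Rg : G -> set R) (Mg : G -> set M)
    (gradR : graded_ring Rg) (gradM : graded_module Rg Mg)
    (M_neq0 : exists m : M, m <> 0) :
  (forall K : set M, graded_submodule Mg K -> K <> [set: M] ->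
     graded_r_submodule Rg Mg K)
  <->
  (forall K : set M, graded_submodule Mg K ->
     forall a : R, (homogeneous Rg `\` zero_divisors M Rg) a ->
       [set a *: x | x in K] = K).
Proof.
split=> [all_r K Kgr a [ha a_reg] | scaleK K Kgr Kproper].
  have Ann0 : Ann M a = [set 0] by apply: contrapT => aN0; apply: a_reg.
  have aKgr := graded_submodule_scale gradM ha Kgr.
  have aKsub := submod_closed_scale_sub (a := a) Kgr.1.
  apply/seteqP; split=> //.
  have [-> //|aKproper] := pselect ([set a *: x | x in K] = [set: M]).
  have [_ _ aKr] := all_r _ aKgr aKproper.
  apply: (graded_submodule_sub Kgr aKgr) => x [Kx hx].
  by apply: aKr hx _ Ann0 => //; exists x.
split=> // a x ha _ Kax Ann0.
have aK : [set a *: y | y in K] = K by apply: scaleK => //; split=> // -[].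
by move: Kax; rewrite -{1}aK => -[k Kk /(Ann0_inj Ann0) <-].
Qed.
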